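(* Let $\bullet(X):=\exists Y.\,\bigl((X\rightarrow(Y\vee\neg Y))\rightarrow X\bigr)$ (Połacik's connective). Any intermediate logic $\mathcal{L}$ that provides a quantifier-free definition of the connective $\bullet$ must prove $$\vdash_{\mathcal{L}}(\neg\neg X)\vee(\neg\neg X\rightarrow X).$$ Consequently, no such logic has the disjunction property.
   Context: Formulas of second-order intuitionistic propositional logic are built from propositional variables and $\bot$ using $\wedge,\vee,\rightarrow$ and the propositional quantifiers $\forall X,\exists X$; $\neg A$ abbreviates $A\rightarrow\bot$. $\Gamma\vdash A$ denotes derivability in the standard Gentzen-style intuitionistic sequent calculus for this language (quantifiers may be instantiated by arbitrary formulas). An intermediate logic $\mathcal{L}$ is a logic obtained from a finitely axiomatizable intermediate propositional logic $L$ (between intuitionistic and classical propositional logic) by setting $\Gamma\vdash_{\mathcal{L}}A$ iff $\Gamma,\Lambda\vdash A$, where $\Lambda$ consists of the second-order universal closures of the axioms of $L$. $\mathcal{L}$ provides a quantifier-free definition of a connective $C(X)$ if there is a quantifier-free formula $\Psi(X)$ in the variable $X$ with $C(X)\vdash_{\mathcal{L}}\Psi(X)$ and $\Psi(X)\vdash_{\mathcal{L}}C(X)$. $\mathcal{L}$ has the disjunction property if for all quantifier-free formulas $A,B$, $\vdash_{\mathcal{L}}A\vee B$ implies $\vdash_{\mathcal{L}}A$ or $\vdash_{\mathcal{L}}B$. *)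

(* Defs.v *)
From Stdlib Require Import List Permutation Arith.
Import ListNotations.

Inductive pform : Type :=
| PVar (n : nat)
| PBot
| PAnd (A B : pform)
| POr (A B : pform)
| PImp (A B : pform).

Fixpoint psubst (s : nat -> pform) (A : pform) : pform :=
  match A with
  | PVar n => s n
  | PBot => PBot
  | PAnd A B => PAnd (psubst s A) (psubst s B)
  | POr A B => POr (psubst s A) (psubst s B)
  | PImp A B => PImp (psubst s A) (psubst s B)
  end.

Fixpoint occurs (x : nat) (A : pform) : Prop :=
  match A with
  | PVar n => n = x
  | PBot => False
  | PAnd A B | POr A B | PImp A B => occurs x A \/ occurs x B
  end.

(* Strict upper bound on the indices of the variables of [A]. *)
Fixpoint pbound (A : pform) : nat :=
  match A with
  | PVar n => S n
  | PBot => 0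
  | PAnd A B | POr A B | PImp A B => Nat.max (pbound A) (pbound B)
  end.

Fixpoint peval (v : nat -> bool) (A : pform) : bool :=
  match A with
  | PVar n => v n
  | PBot => false
  | PAnd A B => andb (peval v A) (peval v B)
  | POr A B => orb (peval v A) (peval v B)
  | PImp A B => implb (peval v A) (peval v B)
  end.

Inductive IPC : pform -> Prop :=
| ipc_K A B : IPC (PImp A (PImp B A))
| ipc_S A B C :
    IPC (PImp (PImp A (PImp B C)) (PImp (PImp A B) (PImp A C)))
| ipc_and_intro A B : IPC (PImp A (PImp B (PAnd A B)))
| ipc_and_left A B : IPC (PImp (PAnd A B) A)
| ipc_and_right A B : IPC (PImp (PAnd A B) B)
| ipc_or_left A B : IPC (PImp A (POr A B))
| ipc_or_right A B : IPC (PImp B (POr A B))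
| ipc_or_elim A B C :
    IPC (PImp (PImp A C) (PImp (PImp B C) (PImp (POr A B) C)))
| ipc_bot A : IPC (PImp PBot A)
| ipc_mp A B : IPC (PImp A B) -> IPC A -> IPC B.

Definition CPC (A : pform) : Prop := forall v : nat -> bool, peval v A = true.

Record intermediate (L : pform -> Prop) : Prop := {
  intermediate_IPC : forall A, IPC A -> L A;
  intermediate_CPC : forall A, L A -> CPC A;
  intermediate_mp : forall A B, L (PImp A B) -> L A -> L B;
  intermediate_subst : forall s A, L A -> L (psubst s A)
}.

Inductive generated (axs : list pform) : pform -> Prop :=
| gen_IPC A : IPC A -> generated axs A
| gen_ax A : In A axs -> generated axs A
| gen_mp A B : generated axs (PImp A B) -> generated axs A -> generated axs B
| gen_subst s A : generated axs A -> generated axs (psubst s A).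

Definition axiomatizes (axs : list pform) (L : pform -> Prop) : Prop :=
  forall A, L A <-> generated axs A.

(* [All] and [Ex] bind index 0 of their argument. *)
Inductive form : Type :=
| Var (n : nat)
| Bot
| And (A B : form)
| Or (A B : form)
| Imp (A B : form)
| All (A : form)
| Ex (A : form).

Definition Neg (A : form) : form := Imp A Bot.

Definition up_ren (r : nat -> nat) (n : nat) : nat :=
  match n with 0 => 0 | S n => S (r n) end.

Fixpoint rename (r : nat -> nat) (A : form) : form :=
  match A with
  | Var n => Var (r n)
  | Bot => Bot
  | And A B => And (rename r A) (rename r B)
  | Or A B => Or (rename r A) (rename r B)
  | Imp A B => Imp (rename r A) (rename r B)
  | All A => All (rename (up_ren r) A)
  | Ex A => Ex (rename (up_ren r) A)
  end.

Definition lift (A : form) : form := rename S A.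

Definition up (s : nat -> form) (n : nat) : form :=
  match n with 0 => Var 0 | S n => lift (s n) end.

Fixpoint subst (s : nat -> form) (A : form) : form :=
  match A with
  | Var n => s n
  | Bot => Bot
  | And A B => And (subst s A) (subst s B)
  | Or A B => Or (subst s A) (subst s B)
  | Imp A B => Imp (subst s A) (subst s B)
  | All A => All (subst (up s) A)
  | Ex A => Ex (subst (up s) A)
  end.

(* [inst B A] replaces index 0 of the quantifier body [A] by [B] and lowers
   the other free indices. *)
Definition inst (B A : form) : form :=
  subst (fun n => match n with 0 => B | S n => Var n end) A.

Fixpoint embed (A : pform) : form :=
  match A with
  | PVar n => Var n
  | PBot => Bot
  | PAnd A B => And (embed A) (embed B)
  | POr A B => Or (embed A) (embed B)
  | PImp A B => Imp (embed A) (embed B)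
  end.

(* All indices below [pbound A] get bound, so indices that do not occur in [A]
   only contribute vacuous quantifiers. *)
Definition universal_closure (A : pform) : form :=
  Nat.iter (pbound A) All (embed A).

(* Gentzen's LJ with exactly one formula on the right. Lifting the context in
   [AllR] and [ExL] is the eigenvariable condition. *)
Inductive derivable : list form -> form -> Prop :=
| Ax A : derivable [A] A
| Weakening G A C : derivable G C -> derivable (A :: G) C
| Contraction G A C : derivable (A :: A :: G) C -> derivable (A :: G) C
| Exchange G D C : Permutation G D -> derivable G C -> derivable D C
| Cut G D A C : derivable G A -> derivable (A :: D) C -> derivable (G ++ D) C
| BotL C : derivable [Bot] C
| AndR G A B : derivable G A -> derivable G B -> derivable G (And A B)
| AndL1 G A B C : derivable (A :: G) C -> derivable (And A B :: G) C
| AndL2 G A B C : derivable (B :: G) C -> derivable (And A B :: G) C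
| OrR1 G A B : derivable G A -> derivable G (Or A B)
| OrR2 G A B : derivable G B -> derivable G (Or A B)
| OrL G A B C :
    derivable (A :: G) C -> derivable (B :: G) C -> derivable (Or A B :: G) C
| ImpR G A B : derivable (A :: G) B -> derivable G (Imp A B)
| ImpL G D A B C :
    derivable G A -> derivable (B :: D) C -> derivable (Imp A B :: G ++ D) C
| AllR G A : derivable (map lift G) A -> derivable G (All A)
| AllL G A B C : derivable (inst B A :: G) C -> derivable (All A :: G) C
| ExR G A B : derivable G (inst B A) -> derivable G (Ex A)
| ExL G A C : derivable (A :: map lift G) (lift C) -> derivable (Ex A :: G) C.

Record logic : Type := {
  logic_prop : pform -> Prop;
  logic_axioms : list pform;
  logic_intermediate : intermediate logic_prop;
  logic_axiomatized : axiomatizes logic_axioms logic_prop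
}.

Definition entails (L : logic) (G : list form) (A : form) : Prop :=
  derivable (G ++ map universal_closure (logic_axioms L)) A.

(* [C] stands for the connective C(X), where X is the variable of index [x]. *)
Definition provides_qf_definition (L : logic) (x : nat) (C : form) : Prop :=
  exists Psi : pform,
    (forall y, occurs y Psi -> y = x) /\
    entails L [C] (embed Psi) /\ entails L [embed Psi] C.

Definition disjunction_property (L : logic) : Prop :=
  forall A B : pform,
    entails L [] (Or (embed A) (embed B)) ->
    entails L [] (embed A) \/ entails L [] (embed B).

(* The bound variable Y is index 0, hence the lifting of [A]. *)
Definition bullet (A : form) : form :=
  Ex (Imp (Imp (lift A) (Or (Var 0) (Neg (Var 0)))) (lift A)).

(* Main.v *)
Require Import Defs.
From Stdlib Require Import List Permutation Arith Lia Classical.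
Import ListNotations.

(** Write [D] for [~~X \/ (~~X -> X)] and call a formula [E] dense when [~~E]
    is derivable. The argument compares the logic with the Heyting algebra
    0 < 1 < 2, the upsets of the Kripke frame that is a chain of two worlds.

    The key is [three_valued_subst]: if [E] is dense, then [Bot], [E] and
    [Bot -> Bot] compute under the propositional connectives exactly like 0, 1
    and 2. It is used twice.

    First, on the axioms. If an axiom is refuted on the two-world chain, replace
    each of its variables by [Bot], [E] or [Bot -> Bot] according to the
    refuting valuation, with [E := X \/ ~X]. The result is a theorem of the
    logic and it implies [E]. So a logic either proves excluded middle
    or is valid on the chain ([lem_or_valid_at_1]). In the former case [D] is
    immediate.

    Second, on the definition [Psi] of the connective, when the logic is
    valid on the chain. There quantifiers range over all upsets, and the
    connective maps the middle element 1 to 1 (every upset [Y] makes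
    [Y \/ ~Y] at least 1). By soundness [Psi] is also below 2 at 1. The
    connective implies [~~X], and under [~~X] the formula [X] is dense, so
    [Psi(X)] implies [X]. Hence the connective applied to [X] entails [X]
    ([bullet_entails_self]). Put [D] for [X]: the instance [Y := X] of the body,
    [(D -> X \/ ~X) -> D], is an intuitionistic theorem, so [D] follows
    ([weak_dne_of_bullet]).

    For the disjunction property, neither [~~X] nor [X] nor [~X] is a classical
    tautology, whereas [~~X -> X] yields [X \/ ~X] by substituting the dense
    formula [X \/ ~X] for [X]. *)

(** * Substitution *)

Definition scons {T : Type} (a : T) (f : nat -> T) (n : nat) : T :=
  match n with 0 => a | S n => f n end.

Lemma subst_ext A : forall s t,
  (forall n, s n = t n) -> subst s A = subst t A.
Proof.
  induction A; intros s t H; simpl; auto; f_equal; eauto; apply IHA;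
    intros [|m]; simpl; auto; unfold lift; congruence.
Qed.

Lemma subst_Var A : forall s, (forall n, s n = Var n) -> subst s A = A.
Proof.
  induction A; intros s H; simpl; auto; f_equal; eauto; apply IHA;
    intros [|m]; simpl; auto; rewrite H; reflexivity.
Qed.

Lemma rename_rename A : forall r t u,
  (forall n, t (r n) = u n) -> rename t (rename r A) = rename u A.
Proof.
  induction A; intros r t u H; simpl; auto; f_equal; eauto; apply IHA;
    intros [|m]; simpl; auto.
Qed.

Lemma subst_rename A : forall r s t,
  (forall n, s (r n) = t n) -> subst s (rename r A) = subst t A.
Proof.
  induction A; intros r s t H; simpl; auto; f_equal; eauto; apply IHA;
    intros [|m]; simpl; auto; rewrite H; reflexivity.
Qed.

Lemma lift_rename r A : rename (up_ren r) (lift A) = lift (rename r A).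
Proof.
  unfold lift.
  rewrite (rename_rename A S (up_ren r) (fun n => S (r n))) by reflexivity.
  now rewrite (rename_rename A r S (fun n => S (r n))) by reflexivity.
Qed.

Lemma rename_subst A : forall s r t,
  (forall n, rename r (s n) = t n) -> rename r (subst s A) = subst t A.
Proof.
  induction A; intros s r t H; simpl; auto; f_equal; eauto; apply IHA;
    intros [|m]; simpl; auto; rewrite lift_rename, H; reflexivity.
Qed.

Lemma lift_subst s A : subst (up s) (lift A) = lift (subst s A).
Proof.
  unfold lift.
  rewrite (subst_rename A S (up s) (fun n => rename S (s n))) by reflexivity.
  now rewrite (rename_subst A s S (fun n => rename S (s n))) by reflexivity.
Qed.

Lemma subst_subst A : forall s t u,
  (forall n, subst t (s n) = u n) -> subst t (subst s A) = subst u A.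
Proof.
  induction A; intros s t u H; simpl; auto; f_equal; eauto; apply IHA;
    intros [|m]; simpl; auto; rewrite lift_subst, H; reflexivity.
Qed.

Lemma inst_subst_up C s A : inst C (subst (up s) A) = subst (scons C s) A.
Proof.
  apply subst_subst. intros [|n]; simpl; [reflexivity|].
  unfold lift. rewrite (subst_rename (s n) S _ Var) by reflexivity.
  now apply subst_Var.
Qed.

Lemma subst_inst s B A : subst s (inst B A) = inst (subst s B) (subst (up s) A).
Proof.
  rewrite inst_subst_up. apply subst_subst. intros [|n]; reflexivity.
Qed.

Lemma subst_bullet s A : subst s (bullet A) = bullet (subst s A).
Proof. unfold bullet, Neg. simpl. now rewrite lift_subst. Qed.

(** By induction on the derivation; the eigenvariable rules use that
    substitution commutes with lifting, the instantiation rules that it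
    commutes with [inst]. *)
Lemma derivable_subst G A :
  derivable G A -> forall s, derivable (map (subst s) G) (subst s A).
Proof.
  assert (Hl : forall s G, map (subst (up s)) (map lift G)
                           = map lift (map (subst s) G)).
  { intros s G'. rewrite !map_map. apply map_ext. apply lift_subst. }
  induction 1; intros s; simpl in *; rewrite ?map_app.
  - apply Ax.
  - now apply Weakening.
  - now apply Contraction.
  - eapply Exchange; [apply Permutation_map; eassumption|auto].
  - eapply Cut; eauto.
  - apply BotL.
  - apply AndR; auto.
  - apply AndL1; auto.
  - apply AndL2; auto.
  - apply OrR1; auto.
  - apply OrR2; auto.
  - apply OrL; auto.
  - apply ImpR; auto.
  - apply ImpL; auto.
  - apply AllR. rewrite <- Hl. auto.
  - apply AllL with (subst s B). rewrite <- subst_inst. auto.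
  - apply ExR with (subst s B). rewrite <- subst_inst. auto.
  - apply ExL. rewrite <- Hl, <- lift_subst. auto.
Qed.

Lemma subst_embed_ext A : forall s t,
  (forall n, occurs n A -> s n = t n) ->
  subst s (embed A) = subst t (embed A).
Proof.
  induction A; intros s t H; simpl in *; f_equal; auto.
Qed.

Lemma occurs_pbound A : forall n, occurs n A -> n < pbound A.
Proof.
  induction A; simpl; intros m H; try lia; destruct H as [H|H];
    (apply IHA1 in H || apply IHA2 in H); lia.
Qed.

Lemma subst_iter_All n B : forall s,
  subst s (Nat.iter n All B) = Nat.iter n All (subst (Nat.iter n up s) B).
Proof.
  induction n as [|n IH]; intros s; [reflexivity|].
  simpl. rewrite IH. do 3 f_equal.
  change (up (Nat.iter n up s)) with (Nat.iter (S n) up s).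
  now rewrite Nat.iter_succ_r.
Qed.

Lemma iter_up_lt n s : forall m, m < n -> Nat.iter n up s m = Var m.
Proof.
  induction n as [|n IH]; intros m H; [lia|]. simpl.
  destruct m as [|m]; simpl; [reflexivity|]. rewrite IH by lia. reflexivity.
Qed.

(** Closures of axioms stay in place when a derivation from them is
    substituted into: this makes entailment closed under substitution. *)
Lemma subst_universal_closure s A :
  subst s (universal_closure A) = universal_closure A.
Proof.
  unfold universal_closure. rewrite subst_iter_All. f_equal.
  rewrite (subst_embed_ext A _ Var).
  - now apply subst_Var.
  - intros n Hn. apply iter_up_lt. now apply occurs_pbound.
Qed.

(** The quantifiers come off from the outside. The outermost of [S n] binds
    index [n] of the body, so the intermediate substitutions [r] are the tails of
    [s]: removing one quantifier extends [r] by one value of [s]. *)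
Lemma derivable_iter_All n B : forall r s,
  (forall m, s (n + m) = r m) ->
  derivable [subst r (Nat.iter n All B)] (subst s B).
Proof.
  induction n as [|n IH]; intros r s H; simpl.
  - rewrite (subst_ext B s r) by auto. apply Ax.
  - apply AllL with (s n). rewrite inst_subst_up. apply IH.
    intros [|m]; simpl.
    + now rewrite Nat.add_0_r.
    + rewrite <- H. f_equal. lia.
Qed.

(** An axiom of a logic can be used in every instance: the universal closure
    is a closed formula, hence equal to its image under the tail of [s]
    that [derivable_iter_All] asks for. *)
Lemma derivable_universal_closure A s :
  derivable [universal_closure A] (subst s (embed A)).
Proof.
  rewrite <- (subst_universal_closure (fun m => s (pbound A + m)) A).
  now apply derivable_iter_All.
Qed.

(** * Natural deduction *)

Lemma derivable_app_absorb G D C :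
  incl G D -> derivable (G ++ D) C -> derivable D C.
Proof.
  induction G as [|A G IH]; simpl; intros Hi Hd; [assumption|].
  apply IH; [intros B HB; apply Hi; now right|].
  assert (HA : In A D) by (apply Hi; now left).
  apply in_split in HA as (D1 & D2 & ->).
  apply (Exchange (A :: G ++ D1 ++ D2)).
  - rewrite !app_assoc. apply Permutation_middle.
  - apply Contraction. revert Hd. apply Exchange. constructor.
    symmetry. rewrite !app_assoc. apply Permutation_middle.
Qed.

(** With the structural rules packed into inclusion, contexts behave like sets,
    which gives the rules of natural deduction below. *)
Lemma derivable_incl G D C : incl G D -> derivable G C -> derivable D C.
Proof.
  intros Hi Hd. apply (derivable_app_absorb G); [assumption|].
  apply (Exchange (D ++ G)); [apply Permutation_app_comm|].
  clear Hi. induction D; simpl; [assumption|]. now apply Weakening.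
Qed.

Lemma derivable_in G A : In A G -> derivable G A.
Proof.
  intros H. apply (derivable_incl [A]); [|apply Ax].
  intros B [<-|[]]. assumption.
Qed.

Lemma derivable_cut G A C :
  derivable G A -> derivable (A :: G) C -> derivable G C.
Proof.
  intros HA HC. apply (derivable_incl (G ++ G)); [|now apply Cut with A].
  now apply incl_app.
Qed.

Lemma Imp_elim G A B : derivable G (Imp A B) -> derivable G A -> derivable G B.
Proof.
  intros HAB HA. apply derivable_cut with (Imp A B); [assumption|].
  apply (derivable_incl (Imp A B :: G ++ [])).
  - rewrite app_nil_r. apply incl_refl.
  - apply ImpL; [assumption|apply Ax].
Qed.

Lemma Bot_elim G A : derivable G Bot -> derivable G A.
Proof.
  intros H. apply derivable_cut with Bot; [assumption|].
  apply (derivable_incl [Bot]); [|apply BotL].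
  intros B [<-|[]]. now left.
Qed.

Lemma Or_elim G A B C :
  derivable G (Or A B) -> derivable (A :: G) C -> derivable (B :: G) C ->
  derivable G C.
Proof. intros H HA HB. apply derivable_cut with (Or A B); auto using OrL. Qed.

Lemma And_elim G A B C :
  derivable G (And A B) -> derivable (A :: B :: G) C -> derivable G C.
Proof.
  intros H HC.
  assert (HA : derivable G A).
  { apply derivable_cut with (And A B); [assumption|].
    apply AndL1, derivable_in. now left. }
  assert (HB : derivable G B).
  { apply derivable_cut with (And A B); [assumption|].
    apply AndL2, derivable_in. now left. }
  apply derivable_cut with B; [assumption|].
  apply derivable_cut with A; [|assumption].
  now apply Weakening.
Qed.

Ltac hyp := solve [apply derivable_in; auto 12 using in_eq, in_cons].

(* The next tactics search for a propositional derivation of depth at most [n].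
   Hypotheses are never dropped; a left rule fires only if it puts a new
   formula into the context. *)
Ltac absent F G :=
  lazymatch G with
  | context [F :: _] => fail
  | _ => idtac
  end.

Ltac search n :=
  lazymatch n with
  | 0 => fail
  | S ?n =>
    first
    [ hyp
    | apply Bot_elim; hyp
    | apply ImpR; search n
    | apply AndR; [search n | search n]
    | match goal with |- derivable ?G _ =>
        match G with context [And ?A ?B :: _] =>
          first [absent A G | absent B G];
          apply (And_elim G A B); [hyp | search n]
        end
      end
    | match goal with |- derivable ?G _ =>
        match G with context [Or ?A ?B :: _] =>
          absent A G; absent B G;
          apply (Or_elim G A B); [hyp | search n | search n]
        end
      end
    | apply OrR1; search n
    | apply OrR2; search n
    | match goal with |- derivable ?G _ =>
        match G with context [Imp ?A ?B :: _] =>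
          absent B G;
          apply (derivable_cut G B);
            [apply (Imp_elim G A B); [hyp | search n] | search n]
        end
      end ]
  end.

(* Iterative deepening keeps the search away from long detours whenever a
   short derivation exists. *)
Ltac ipc :=
  unfold Neg in *;
  first [search 4 | search 5 | search 6 | search 7 | search 8].

Ltac use H :=
  eapply derivable_cut;
  [ refine (derivable_incl _ _ _ _ H); repeat apply incl_tl; apply incl_refl | ].

(** * The formula [~~A \/ (~~A -> A)] *)

Definition weak_dne (A : form) : form :=
  Or (Neg (Neg A)) (Imp (Neg (Neg A)) A).

Lemma derivable_not_not_lem G A : derivable G (Neg (Neg (Or A (Neg A)))).
Proof. ipc. Qed.

Lemma weak_dne_of_lem G A :
  derivable G (Or A (Neg A)) -> derivable G (weak_dne A).
Proof. intros H. use H. unfold weak_dne. ipc. Qed.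

(** If [~A], then [A -> Y \/ ~Y] holds for every [Y], and the body of the
    connective yields [A]. *)
Lemma bullet_not_not G A : derivable (bullet A :: G) (Neg (Neg A)).
Proof.
  apply ExL. simpl. change (rename S A) with (lift A).
  ipc.
Qed.

(** The connective is derivable at [D := weak_dne A], with witness [Y := A].
    Assume [D -> A \/ ~A]; to get [D] by its right disjunct, assume [~~A]. Then
    [D] holds by its left disjunct, so [A \/ ~A], and [~~A] leaves [A]. *)
Lemma weak_dne_of_bullet G A :
  derivable (bullet (weak_dne A) :: G) (weak_dne A) -> derivable G (weak_dne A).
Proof.
  intros H. apply derivable_cut with (bullet (weak_dne A)); [|assumption].
  apply ExR with A.
  change (derivable G (Imp (Imp (inst A (lift (weak_dne A))) (Or A (Neg A)))
                           (inst A (lift (weak_dne A))))).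
  replace (inst A (lift (weak_dne A))) with (weak_dne A).
  - unfold weak_dne. ipc.
  - unfold inst, lift. erewrite subst_rename by reflexivity.
    symmetry. now apply subst_Var.
Qed.

(** * Kripke semantics on a chain *)

(** The worlds are the natural numbers and a world sees the smaller ones. An
    upset is given by the number of worlds in it, which is why valuations take
    values in [nat]. The worlds below [S i] form a chain of [S i] elements, so
    truth at world 0 is classical truth, and truth at world 1 is truth on the
    two-element chain. *)
Fixpoint forces (i : nat) (v : nat -> nat) (A : form) : Prop :=
  match A with
  | Var n => i < v n
  | Bot => False
  | And A B => forces i v A /\ forces i v B
  | Or A B => forces i v A \/ forces i v B
  | Imp A B => forall j, j <= i -> forces j v A -> forces j v B
  | All A => forall k, forces i (scons k v) A
  | Ex A => exists k, forces i (scons k v) A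
  end.

Lemma forces_mono A : forall i j v, j <= i -> forces i v A -> forces j v A.
Proof.
  induction A; simpl; intros i j v Hj H.
  - lia.
  - assumption.
  - destruct H; eauto.
  - destruct H; eauto.
  - intros k Hk. apply H. lia.
  - eauto.
  - destruct H; eauto.
Qed.

Lemma forces_rename A : forall i r v w,
  (forall n, w n = v (r n)) -> forces i v (rename r A) <-> forces i w A.
Proof.
  induction A; simpl; intros i r v w H.
  - now rewrite H.
  - tauto.
  - rewrite (IHA1 i r v w H), (IHA2 i r v w H). tauto.
  - rewrite (IHA1 i r v w H), (IHA2 i r v w H). tauto.
  - split; intros HI j Hj;
      specialize (HI j Hj); pose proof (IHA1 j r v w H);
      pose proof (IHA2 j r v w H); tauto.
  - assert (E : forall k, forces i (scons k v) (rename (up_ren r) A)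
                          <-> forces i (scons k w) A).
    { intros k. apply IHA. intros [|n]; simpl; auto. }
    firstorder.
  - assert (E : forall k, forces i (scons k v) (rename (up_ren r) A)
                          <-> forces i (scons k w) A).
    { intros k. apply IHA. intros [|n]; simpl; auto. }
    firstorder.
Qed.

Lemma forces_lift i k v A : forces i (scons k v) (lift A) <-> forces i v A.
Proof. now apply forces_rename. Qed.

Lemma forces_subst A : forall i s v w,
  (forall j n, j <= i -> j < w n <-> forces j v (s n)) ->
  forall j, j <= i -> forces j v (subst s A) <-> forces j w A.
Proof.
  induction A; simpl; intros i s v w H j Hj.
  - symmetry. auto.
  - tauto.
  - rewrite (IHA1 i s v w H j Hj), (IHA2 i s v w H j Hj). tauto.
  - rewrite (IHA1 i s v w H j Hj), (IHA2 i s v w H j Hj). tauto.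
  - split; intros HI l Hl; specialize (HI l Hl);
      pose proof (IHA1 i s v w H l ltac:(lia));
      pose proof (IHA2 i s v w H l ltac:(lia)); tauto.
  - assert (E : forall k, forces j (scons k v) (subst (up s) A)
                          <-> forces j (scons k w) A).
    { intros k. apply (IHA i); [|assumption].
      intros l [|n] Hl; simpl; [tauto|]. rewrite forces_lift. auto. }
    firstorder.
  - assert (E : forall k, forces j (scons k v) (subst (up s) A)
                          <-> forces j (scons k w) A).
    { intros k. apply (IHA i); [|assumption].
      intros l [|n] Hl; simpl; [tauto|]. rewrite forces_lift. auto. }
    firstorder.
Qed.

(** Second-order quantifiers range over all upsets, so instantiating them with
    [B] needs the upset of the worlds that force [B]. It may contain all worlds
    and then has no size, but only the worlds up to [i] matter at [i]. *)
Lemma forces_comprehension v B i :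
  exists k, forall j, j <= i -> j < k <-> forces j v B.
Proof.
  induction i as [|i [k Hk]].
  - destruct (classic (forces 0 v B)) as [H|H]; [exists 1|exists 0];
      intros j Hj; replace j with 0 by lia; intuition lia.
  - destruct (classic (forces (S i) v B)) as [H|H].
    + exists (S (S i)). intros j Hj. split; [|lia].
      intros _. now apply forces_mono with (S i).
    + exists (min k (S i)). intros j Hj.
      destruct (Nat.eq_dec j (S i)) as [->|Hne].
      * split; [lia|contradiction].
      * rewrite <- Hk by lia. lia.
Qed.

Lemma forces_inst v B A i :
  exists k, forces i v (inst B A) <-> forces i (scons k v) A.
Proof.
  destruct (forces_comprehension v B i) as [k Hk]. exists k.
  apply (forces_subst A i); [|lia].
  intros j [|n] Hj; simpl; [auto|tauto].
Qed.

Lemma Forall_forces_mono G i j v :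
  j <= i -> Forall (forces i v) G -> Forall (forces j v) G.
Proof.
  intros Hj. apply Forall_impl. intros A. now apply forces_mono.
Qed.

Lemma Forall_forces_lift G i k v :
  Forall (forces i v) G -> Forall (forces i (scons k v)) (map lift G).
Proof.
  intros H. apply Forall_map. revert H. apply Forall_impl.
  intros A. apply forces_lift.
Qed.

Lemma soundness G C :
  derivable G C -> forall i v, Forall (forces i v) G -> forces i v C.
Proof.
  induction 1; intros i v HG;
    try (apply Forall_cons_iff in HG as [HA HG]); simpl in *.
  - assumption.
  - auto.
  - auto.
  - apply IHderivable. revert HG. apply Permutation_Forall. now symmetry.
  - apply Forall_app in HG as [HG HD]. auto.
  - contradiction.
  - auto.
  - apply IHderivable. constructor; tauto.
  - apply IHderivable. constructor; tauto.
  - auto.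
  - auto.
  - destruct HA; auto.
  - intros j Hj HA. apply IHderivable. constructor; [assumption|].
    now apply Forall_forces_mono with i.
  - apply Forall_app in HG as [HG HD]. eauto.
  - intros k. apply IHderivable. now apply Forall_forces_lift.
  - apply IHderivable. constructor; [|assumption].
    destruct (forces_inst v B A i) as [k Hk]. apply Hk, HA.
  - destruct (forces_inst v B A i) as [k Hk]. exists k. apply Hk. auto.
  - destruct HA as [k Hk]. apply (forces_lift i k).
    apply IHderivable. constructor; [assumption|].
    now apply Forall_forces_lift.
Qed.

Definition valid_at (i : nat) (A : form) : Prop := forall v, forces i v A.

Lemma valid_at_universal_closure i A :
  valid_at i (embed A) -> valid_at i (universal_closure A).
Proof.
  intros H. unfold universal_closure.
  induction (pbound A) as [|n IH]; simpl; [assumption|].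
  intros v k. apply IH.
Qed.

(** World 0 sees only itself. *)
Lemma forces_0_peval A v :
  forces 0 v (embed A) <-> peval (fun n => 0 <? v n) A = true.
Proof.
  induction A as [n| |A IHA B IHB|A IHA B IHB|A IHA B IHB]; simpl.
  - now rewrite Nat.ltb_lt.
  - intuition discriminate.
  - rewrite Bool.andb_true_iff. tauto.
  - rewrite Bool.orb_true_iff. tauto.
  - rewrite Bool.implb_true_iff, <- IHA, <- IHB. split; intros H.
    + apply H; lia.
    + intros j Hj. replace j with 0 by lia. assumption.
Qed.

Lemma entails_sound L i :
  Forall (fun A => valid_at i (embed A)) (logic_axioms L) ->
  forall G C v, entails L G C -> Forall (forces i v) G -> forces i v C.
Proof.
  intros HL G C v H HG. apply (soundness _ _ H). apply Forall_app. split.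
  - assumption.
  - apply Forall_map. revert HL. apply Forall_impl.
    intros A HA. now apply valid_at_universal_closure.
Qed.

Lemma entails_sound_0 L C : entails L [] C -> valid_at 0 C.
Proof.
  intros H v. apply (entails_sound L 0) with (G := []); auto.
  apply Forall_forall. intros A HA w. apply forces_0_peval.
  apply (intermediate_CPC _ (logic_intermediate L)).
  apply (logic_axiomatized L). now apply gen_ax.
Qed.

(** * The three-element Heyting algebra of a dense formula *)

Definition code (E : form) (k : nat) : form :=
  match k with 0 => Bot | 1 => E | _ => Imp Bot Bot end.

(** Pairs the value of [A] in the algebra 0 < 1 < 2, read off from the worlds at
    which [A] holds, with the matching equivalence of [F] with [code E] of this
    value. *)
Inductive three_valued (G : list form) (E : form) (v : nat -> nat)
    (A : pform) (F : form) : Prop :=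
| value_0 : ~ forces 0 v (embed A) -> derivable G (Neg F) ->
    three_valued G E v A F
| value_1 : forces 0 v (embed A) -> ~ forces 1 v (embed A) ->
    derivable G (Imp E F) -> derivable G (Imp F E) ->
    three_valued G E v A F
| value_2 : forces 1 v (embed A) -> derivable G F -> three_valued G E v A F.

Lemma forces_1_Imp v A B :
  forces 1 v (Imp A B) <-> (forces 1 v A -> forces 1 v B)
                           /\ (forces 0 v A -> forces 0 v B).
Proof.
  simpl. split; [auto|]. intros [H1 H0] [|[|j]] Hj; auto. lia.
Qed.

Lemma forces_0_Imp v A B :
  forces 0 v (Imp A B) <-> (forces 0 v A -> forces 0 v B).
Proof.
  simpl. split; [auto|]. intros H j Hj. replace j with 0 by lia. assumption.
Qed.

(* Derivability facts from the goal's hypotheses become members of the context. *)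
Ltac ipc_with_hyps :=
  repeat match goal with H : derivable _ _ |- _ => use H; clear H end; ipc.

Ltac table_entry :=
  solve [ cbn [embed]; rewrite ?forces_1_Imp, ?forces_0_Imp; simpl; tauto
        | ipc_with_hyps ].

Ltac by_table :=
  first
  [ apply value_2; table_entry
  | apply value_1; table_entry
  | apply value_0; table_entry ].

(** By induction on [A], from the tables of the connectives. Density of [E]
    enters in the table of implication: it gives 1 -> 0 the value 0. *)
Lemma three_valued_subst G E v A :
  derivable G (Neg (Neg E)) ->
  three_valued G E v A (subst (fun n => code E (v n)) (embed A)).
Proof.
  intros HE.
  assert (Hm : forall A, forces 1 v A -> forces 0 v A).
  { intros A'. apply forces_mono. lia. }
  induction A as [n| |A IHA B IHB|A IHA B IHB|A IHA B IHB]; simpl.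
  - destruct (v n) as [|[|k]] eqn:Hk; simpl;
      [apply value_0|apply value_1|apply value_2]; simpl; try lia;
      unfold Neg; apply ImpR, derivable_in; now left.
  - apply value_0; simpl; [tauto|]. apply ImpR, derivable_in. now left.
  - pose proof (Hm (embed A)); pose proof (Hm (embed B)).
    destruct IHA, IHB; by_table.
  - pose proof (Hm (embed A)); pose proof (Hm (embed B)).
    destruct IHA, IHB; by_table.
  - pose proof (Hm (embed A)); pose proof (Hm (embed B)).
    destruct IHA, IHB; by_table.
Qed.

(** * The dichotomy for intermediate logics *)

Lemma entails_subst L s G C :
  entails L G C -> entails L (map (subst s) G) (subst s C).
Proof.
  intros H. apply (derivable_subst _ _) with (s := s) in H.
  rewrite map_app, map_map in H.
  erewrite (map_ext (fun A => subst s (universal_closure A))) in H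
    by apply subst_universal_closure.
  exact H.
Qed.

Lemma entails_axiom_instance L A s :
  In A (logic_axioms L) -> entails L [] (subst s (embed A)).
Proof.
  intros HA. apply (derivable_incl [universal_closure A]).
  - intros B [<-|[]]. now apply in_map.
  - apply derivable_universal_closure.
Qed.

(** Every logic other than the classical one is valid on the chain of
    two worlds: a valuation refuting an axiom gives an instance of it that
    implies the dense formula [B \/ ~B]. *)
Lemma lem_or_valid_at_1 L B :
  entails L [] (Or B (Neg B)) \/
  Forall (fun A => valid_at 1 (embed A)) (logic_axioms L).
Proof.
  destruct (classic (entails L [] (Or B (Neg B)))) as [H|H]; [now left|right].
  apply Forall_forall. intros A HA v.
  apply NNPP. intros HF. apply H.
  pose proof (entails_axiom_instance L A
    (fun n => code (Or B (Neg B)) (v n)) HA) as HI.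
  pose proof (derivable_not_not_lem (map universal_closure (logic_axioms L)) B)
    as HE.
  unfold entails in *. simpl app in *.
  destruct (three_valued_subst _ _ v A HE) as [_ HT|_ _ _ HT|HT _].
  - apply Bot_elim. exact (Imp_elim _ _ _ HT HI).
  - exact (Imp_elim _ _ _ HT HI).
  - contradiction.
Qed.

(** * Polacik's connective *)

(** At world 0 every formula is decided. So if [X] holds at 0 only, then
    [X -> Y \/ ~Y] holds at 1 for every [Y] although [X] does not. *)
Lemma not_forces_bullet x v :
  v x = 1 -> ~ forces 1 v (bullet (Var x)).
Proof.
  intros Hx [k Hk]. simpl in Hk.
  enough (1 < v x) by lia. apply (Hk 1); [lia|].
  intros j Hj Hjx. assert (j = 0) as -> by lia.
  destruct (Nat.eq_dec k 0) as [->|]; [right|left; lia].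
  intros l _. lia.
Qed.

(** The definition [Psi] fails at world 1 when [X] has value 1, because it
    entails the connective. The connective gives [~~X], so [X] serves as the
    dense formula and each variable of [Psi] stands for itself. Hence [Psi]
    is equivalent to [Bot] or to [X]. *)
Lemma bullet_entails_self L x :
  Forall (fun A => valid_at 1 (embed A)) (logic_axioms L) ->
  provides_qf_definition L x (bullet (Var x)) ->
  entails L [bullet (Var x)] (Var x).
Proof.
  intros HL (Psi & Hocc & HbP & HPb).
  set (v := fun _ : nat => 1).
  assert (HF : ~ forces 1 v (embed Psi)).
  { intros HF. apply (not_forces_bullet x v); [reflexivity|].
    apply (entails_sound L 1 HL _ _ v HPb). now repeat constructor. }
  unfold entails in *.
  pose proof (three_valued_subst
    ([bullet (Var x)] ++ map universal_closure (logic_axioms L)) (Var x) v Psi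
    (bullet_not_not _ _)) as HT.
  rewrite (subst_embed_ext Psi _ Var) in HT
    by (intros n Hn; apply Hocc in Hn as ->; reflexivity).
  rewrite subst_Var in HT by reflexivity.
  destruct HT as [_ HT|_ _ _ HT|HT _].
  - apply Bot_elim. exact (Imp_elim _ _ _ HT HbP).
  - exact (Imp_elim _ _ _ HT HbP).
  - contradiction.
Qed.

Lemma entails_weak_dne L x :
  provides_qf_definition L x (bullet (Var x)) ->
  entails L [] (weak_dne (Var x)).
Proof.
  intros Hdef. destruct (lem_or_valid_at_1 L (Var x)) as [HL|HL].
  - now apply weak_dne_of_lem.
  - apply weak_dne_of_bullet.
    pose proof (entails_subst L (fun _ => weak_dne (Var x)) _ _
                  (bullet_entails_self L x HL Hdef)) as H.
    cbn [map] in H. rewrite subst_bullet in H. exact H.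
Qed.

(** One disjunct of [weak_dne] is classically refutable. The other one makes
    the logic classical, and excluded middle violates the disjunction
    property. *)
Lemma not_disjunction_property L x :
  entails L [] (weak_dne (Var x)) -> ~ disjunction_property L.
Proof.
  intros HD HDP.
  assert (Hlem : entails L [] (Or (Var x) (Neg (Var x)))).
  { destruct (HDP (PImp (PImp (PVar x) PBot) PBot)
                  (PImp (PImp (PImp (PVar x) PBot) PBot) (PVar x)) HD)
      as [H|H].
    - apply entails_sound_0 in H.
      exfalso. apply (H (fun _ => 0) 0); [lia|]. intros j _. simpl. lia.
    - apply (entails_subst L (fun _ => Or (Var x) (Neg (Var x)))) in H.
      apply (Imp_elim _ _ _ H), derivable_not_not_lem. }
  destruct (HDP (PVar x) (PImp (PVar x) PBot) Hlem) as [H|H];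
    apply entails_sound_0 in H.
  - specialize (H (fun _ => 0)). simpl in H. lia.
  - apply (H (fun _ => 1) 0); simpl; lia.
Qed.

Theorem corollary5p14 (L : logic) (x : nat)
  (hdef : provides_qf_definition L x (bullet (Var x))) :
  entails L [] (Or (Neg (Neg (Var x))) (Imp (Neg (Neg (Var x))) (Var x))) /\
  ~ disjunction_property L.
Proof.
  pose proof (entails_weak_dne L x hdef) as HD.
  split; [exact HD|]. exact (not_disjunction_property L x HD).
Qed.
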